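(* There exists a function $f:(0,1]\to\mathbb{N}$ such that the following holds. Let $L$ be a finite Lie ring and let $\varepsilon=\mathrm{cp}(L)$. Then there exists an ideal $D$ of $L$ such that $[L:D]\le f(\varepsilon)$ and $\lvert [D,D]\rvert\le f(\varepsilon)$.
   Context: For a finite Lie ring $L$ with bracket $[\cdot,\cdot]$, the commuting probability is $\mathrm{cp}(L)=\lvert\{(x,y)\in L\times L\mid [x,y]=0\}\rvert/\lvert L\rvert^2$. The index $[L:D]$ is the index of $(D,+)$ in $(L,+)$ as additive groups. $[D,D]$ is the additive subgroup of $L$ generated by all brackets $[d_1,d_2]$ with $d_1,d_2\in D$. The function $f$ depends only on $\varepsilon$ and not on $L$. *)

(* Defs.v *)
From HB Require Import structures.
From mathcomp Require Import all_boot all_order all_algebra all_fingroup.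
From mathcomp Require Import reals.

Set Implicit Arguments.
Unset Strict Implicit.
Unset Printing Implicit Defensive.

Import Order.TTheory GRing.Theory Num.Theory.
Local Open Scope ring_scope.

HB.mixin Record Zmodule_isLieRing L of GRing.Zmodule L := {
  lie : L -> L -> L;
  lieDl : forall x y z, lie (x + y) z = lie x z + lie y z;
  lieDr : forall x y z, lie x (y + z) = lie x y + lie x z;
  liexx : forall x, lie x x = 0;
  lie_jacobi : forall x y z,
    lie x (lie y z) + lie y (lie z x) + lie z (lie x y) = 0
}.

#[short(type="lieRingType")]
HB.structure Definition LieRing :=
  {L of GRing.Zmodule L & Zmodule_isLieRing L}.

#[short(type="finLieRingType")]
HB.structure Definition FinLieRing := {L of LieRing L & Finite L}.

(* As for finZmodType in finalg, a finite Lie ring is viewed as a finite group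
   under addition. Thus {group L} is the type of additive subgroups of L,
   #|A : B| is the additive index and <<A>> is the additive subgroup
   generated by A. *)
HB.instance Definition _ (L : FinLieRing.type) :=
  [finGroupMixin of L for +%R].
Coercion FinLieRing_to_baseFinGroup (L : FinLieRing.type) :=
  FinStarMonoid.clone L _.
Coercion FinLieRing_to_finGroup (L : FinLieRing.type) :=
  FinGroup.clone L _.

(* One side suffices, since lie is antisymmetric. *)
Definition lie_ideal (L : finLieRingType) (D : {group L}) : Prop :=
  forall x d : L, d \in D -> lie x d \in D.

Definition lie_derived (L : finLieRingType) (D : {group L}) : {group L} :=
  <<[set lie x y | x in D, y in D]>>%G.

Definition cp (R : realType) (L : finLieRingType) : R :=
  #|[set p : L * L | lie p.1 p.2 == 0]|%:R / #|L|%:R ^+ 2.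

Definition unit_oc (R : realType) := {e : R | 0 < e <= 1}.

Lemma cp_itv (R : realType) (L : finLieRingType) : 0 < cp R L <= 1.
Proof.
have L0 : (0 < #|L|)%N by apply/card_gt0P; exists 0.
have L2 : 0 < #|L|%:R ^+ 2 :> R by rewrite exprn_gt0 // ltr0n.
apply/andP; split; rewrite /cp.
  rewrite divr_gt0 // ltr0n; apply/card_gt0P; exists (0, 0).
  by rewrite inE /= liexx.
rewrite ler_pdivrMr // mul1r -natrX ler_nat.
by rewrite (leq_trans (max_card _)) // card_prod.
Qed.

Definition cp_oc (R : realType) (L : finLieRingType) : unit_oc R :=
  exist _ (cp R L) (cp_itv R L).

(* Main.v *)
Require Import Defs.
From HB Require Import structures.
From mathcomp Require Import all_boot all_order all_algebra all_fingroup.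
From mathcomp Require Import reals.

(** The proof is P. M. Neumann's, in a form adapted to Lie rings.  Call x
    n-central if [x, L] has at most n elements; since the centraliser of x has
    index |[x, L]|, this says that x commutes with a large part of L.

    If cp(L) >= 1/k, averaging over x shows that at least |L|/(2k) elements are
    2k-central ([card_near_central]).  The n-central elements need not form a
    subgroup, but for fixed n the sum of two of them is n^2-central, and so is
    the bracket of one of them with any element of L: by the Jacobi identity
    [[z, x], L] lies in [z, [x, L]] + [x, L].  Hence along n, n^2, n^4, ...
    the sets of near-central elements increase, each absorbing the sums and
    brackets of the one before.  A dense increasing chain of this sort can grow
    only boundedly often ([squaring_chain_stalls]), and a term equal to its
    successor is an ideal D ([near_central_ideal]).  Its index is at most 2k,
    and all its elements are m-central for some m depending only on k.

    It remains to see that [D, D] is bounded in terms of m, which is the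
    additive analogue of B. H. Neumann's theorem on groups with boundedly
    finite conjugacy classes ([card_lie_derived]).  Choose a in D with [a, D]
    as large as possible, and finitely many t in D representing all values
    [a, t].  If c in D commutes with these t, then [a + c, D] contains all
    [a, t], hence equals [a, D] by maximality, so that [c, D] lies in [a, D].
    Such c form a subgroup of bounded index in D; thus [D, D] is contained in
    the sum of [a, D] and of boundedly many further [s, D]. *)

Set Implicit Arguments.
Unset Strict Implicit.
Unset Printing Implicit Defensive.

Import Order.TTheory GRing.Theory Num.Theory GroupScope.

(** * Finite sets and groups *)

Lemma card_mulg_leq (gT : finGroupType) (A B : {set gT}) :
  #|A * B| <= #|A| * #|B|.
Proof. by rewrite -cardsX [A * B]curry_imset2X leq_imset_card. Qed.

Lemma card_joing_leq (gT : finGroupType) (G H : {group gT}) :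
  commute (G : {set gT}) H -> #|G <*> H| <= #|G| * #|H|.
Proof. by move/comm_joingE->; apply: card_mulg_leq. Qed.

Lemma imset_transversal (aT rT : finType) (f : aT -> rT) (A : {set aT}) :
  exists S : {set aT}, [/\ S \subset A, f @: S = f @: A & #|S| = #|f @: A|].
Proof.
pose g v := [pick x in A | f x == v].
have gP v : v \in f @: A -> exists x, [/\ g v = Some x, x \in A & f x = v].
  case/imsetP=> x xA ->; rewrite /g; case: pickP => [y /andP[yA /eqP fy]|no].
    by exists y.
  by have := no x; rewrite xA eqxx.
pose S := [set x in A | g (f x) == Some x].
have fS : f @: S = f @: A.
  apply/eqP; rewrite eqEsubset imsetS ?subsetIl //=; last first.
    by apply/subsetP=> x; rewrite inE => /andP[].
  apply/subsetP=> v vA; have [x [gv xA fx]] := gP v vA.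
  by apply/imsetP; exists x; rewrite // inE xA fx gv eqxx.
exists S; split=> //; first by apply/subsetP=> x; rewrite inE => /andP[].
rewrite -fS card_in_imset // => x y; rewrite !inE => /andP[_ /eqP gx].
by case/andP=> _ /eqP gy fxy; move: gx; rewrite fxy gy => -[].
Qed.

(** While the chain grows, three steps double the cardinality: if x lies in
    [E (i + 2)] but not in [E (i + 1)], then [E i] and its translate by x are
    disjoint, as x is not a quotient of elements of [E i], and both lie in
    [E (i + 3)]. *)
Lemma squaring_chain_stalls (gT : finGroupType) (E : nat -> {set gT}) t :
    (forall i, 1 \in E i) -> (forall i x, x \in E i -> x^-1 \in E i) ->
    (forall i, E i * E i \subset E i.+1) -> #|gT| < 2 ^ t * #|E 0| ->
  exists2 j, j < 3 * t & E j = E j.+1.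
Proof.
move=> E1 EV EM big.
have ES i : E i \subset E i.+1.
  apply/subsetP=> x xE; rewrite -(mulg1 x).
  exact: (subsetP (EM i)) (mem_mulg xE (E1 i)).
case: (pickP (fun j : 'I_(3 * t) => E j == E j.+1)) => [j /eqP|no].
  by exists j.
have grow u : u <= t -> 2 ^ u * #|E 0| <= #|E (3 * u)%N|.
  elim: u => [|u IHu] ltut; first by rewrite mul1n.
  have lt1 : ((3 * u).+1 < 3 * t)%N.
    by rewrite (@leq_trans (3 * u.+1)%N) ?leq_mul2l // mulnS addnC !addnS addn0.
  have /= := no (Ordinal lt1).
  rewrite eqEsubset ES /= => /negbT/subsetPn[x xE2 xE1].
  have -> : (3 * u.+1 = (3 * u).+3)%N by rewrite mulnS.
  have disj : [disjoint x *: E (3 * u)%N & E (3 * u)%N].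
    apply/pred0P=> y /=; apply/negP=> /andP[/lcosetP[e eE ->] xeE].
    case/negP: xE1; rewrite -(mulgK e x).
    by apply: (subsetP (EM _)); rewrite mem_mulg ?EV.
  have sub : x *: E (3 * u)%N :|: E (3 * u)%N \subset E (3 * u)%N.+3.
    rewrite subUset (subset_trans (ES _) (subset_trans (ES _) (ES _))) andbT.
    apply: subset_trans (EM _); apply: mulgSS; first by rewrite sub1set.
    exact: subset_trans (ES _) (ES _).
  apply: leq_trans (subset_leq_card sub).
  rewrite cardsU disjoint_setI0 // cards0 subn0 card_lcoset addnn -mul2n.
  by rewrite expnS -mulnA leq_mul2l IHu // ltnW.
have := leq_trans (grow t (leqnn t)) (max_card _).
by rewrite leqNgt big.
Qed.

(** * Images of inner derivations *)

Section LieImages.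

Variable L : finLieRingType.
Implicit Types (x y z : L) (D : {group L}).

Lemma lie0r x : lie x 0%R = 0%R.
Proof. by apply: (addrI (lie x 0%R)); rewrite -lieDr !addr0. Qed.

Lemma lieC x y : lie x y = (- lie y x)%R.
Proof.
apply/eqP; rewrite -addr_eq0; apply/eqP.
by have := liexx (x + y)%R; rewrite lieDl !lieDr !liexx add0r addr0.
Qed.

Lemma lie0l x : lie 0%R x = 0%R.
Proof. by rewrite lieC lie0r oppr0. Qed.

Lemma lieNl x y : lie (- x)%R y = (- lie x y)%R.
Proof. by apply/eqP; rewrite -addr_eq0 -lieDl addNr lie0l. Qed.

Lemma lieNr x y : lie x (- y)%R = (- lie x y)%R.
Proof. by rewrite lieC lieNl -lieC. Qed.

Lemma lie_lie x y z : lie (lie x y) z = (lie x (lie y z) - lie y (lie x z))%R.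
Proof.
have := lie_jacobi x y z; rewrite (lieC z x) (lieC z) lieNr => /eqP.
by rewrite subr_eq0 => /eqP <-.
Qed.

Definition lie_morph x : {morphism [set: L] >-> L} :=
  @Morphism _ _ [set: L] (lie x) (fun y z _ _ => lieDr x y z).

Lemma lie_imset_group_set x D : group_set (lie x @: D).
Proof.
have -> : lie x @: D = lie_morph x @* D by rewrite morphimEsub ?subsetT.
exact: groupP.
Qed.
Canonical lie_imset_group x D : {group L} := Group (lie_imset_group_set x D).

Lemma card_lie_centraliser x :
  (#|[set y | lie x y == 0%R]| * #|lie x @: [set: L]| = #|L|)%N.
Proof.
have -> : lie x @: [set: L] = lie_morph x @* [set: L].
  by rewrite morphimEsub ?subsetT.
have -> : [set y | lie x y == 0%R] = 'ker (lie_morph x).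
  by apply/setP=> y; rewrite !inE.
by rewrite card_morphim setIid Lagrange ?subsetT ?cardsT.
Qed.

Lemma lie_imset_sum (s : seq L) m D :
    (forall x, x \in s -> #|lie x @: D| <= m) ->
  exists2 W : {group L}, #|W| <= m ^ size s &
    forall x, x \in s -> lie x @: D \subset W.
Proof.
elim: s => [|x s IHs] bnd; first by exists 1%G; rewrite ?cards1.
have [y ys|W cW sW] := IHs; first by apply: bnd; rewrite inE ys orbT.
have addWC : commute (lie_imset_group x D : {set L}) W.
  by apply/normC/cents_norm/centsP=> u _ v _; apply: addrC.
exists (@joing_group L (lie_imset_group x D) W) => [|y].
  rewrite expnS; apply: leq_trans (card_joing_leq addWC) (leq_mul _ cW).
  by apply: bnd; rewrite mem_head.
rewrite inE => /predU1P[->|/sW sy].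
  exact: (@joing_subl L (lie_imset_group x D) W).
exact: subset_trans sy (@joing_subr L (lie_imset_group x D) W).
Qed.

(** * The bound on the derived subring *)

(** The exponent counts the subgroups whose sum contains [D, D]: the image of
    ad a for one a of maximal image, and those for at most m ^ m
    representatives. *)
Lemma card_lie_derived D m :
    (forall d, d \in D -> #|lie d @: D| <= m) ->
  #|lie_derived D| <= m ^ (m ^ m).+1.
Proof.
move=> bnd.
have m_gt0 : 0 < m.
  exact: leq_trans (cardG_gt0 (lie_imset_group 1 D)) (bnd 1 (group1 D)).
have [a aD amax] := @arg_maxnP L 1 (mem D) (fun a => #|lie a @: D|) (group1 D).
have {}amax d : d \in D -> #|lie d @: D| <= #|lie a @: D| by apply: amax.
have [T [sTD imT cT]] := imset_transversal (lie a) D.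
(* Two elements of D with the same val_T differ by an element that commutes
   with T; so S represents D modulo the elements commuting with T. *)
pose val_T d : {ffun L -> L} := [ffun t => if t \in T then lie d t else 0%R].
have [S [sSD imS cS]] := imset_transversal val_T D.
have {}cS : #|S| <= m ^ m.
  rewrite cS; apply: (@leq_trans (m ^ #|T|)%N); last first.
    by rewrite leq_pexp2l // cT bnd.
  have sub : val_T @: D \subset pfamily 0%R (mem T) (fun t => mem (lie t @: D)).
    apply/subsetP=> _ /imsetP[d dD ->]; apply/pfamilyP; split.
      by apply/supportP=> t tT; rewrite ffunE (negPf tT).
    move=> t tT; rewrite ffunE tT lieC -lieNr.
    by apply: imset_f; apply: (@groupVr L).
  apply: leq_trans (subset_leq_card sub) _; rewrite card_pfamily.
  rewrite cardE /image_mem.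
  have : {subset enum T <= T} by move=> t; rewrite mem_enum.
  elim: (enum T) => //= t s IHs sT; rewrite expnS leq_mul ?bnd //.
    by apply: (subsetP sTD); apply: sT; rewrite mem_head.
  by apply: IHs => u us; apply: sT; rewrite inE us orbT.
(* By maximality of a, adding c to a does not enlarge the image of D. *)
have killT c : c \in D -> (forall t, t \in T -> lie c t = 0%R) ->
    lie c @: D \subset lie a @: D.
  move=> cD cT0.
  have acD : (a + c)%R \in D := groupM aD cD.
  have /eqP im_ac : lie a @: D == lie (a + c)%R @: D.
    rewrite eqEcard (amax _ acD) andbT -imT; apply/subsetP=> _ /imsetP[t tT ->].
    apply/imsetP; exists t; first exact: (subsetP sTD).
    by rewrite lieDl cT0 // addr0.
  apply/subsetP=> _ /imsetP[y yD ->].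
  have -> : lie c y = (lie (a + c)%R y - lie a y)%R by rewrite lieDl addrC addKr.
  apply: (@groupM _ (lie_imset_group a D)); first by rewrite /= im_ac imset_f.
  by apply: (@groupVr _ (lie_imset_group a D)); apply: imset_f.
have [x|W cW sW] := @lie_imset_sum (a :: enum S) m D.
  rewrite inE => /predU1P[->|]; first exact: bnd.
  by rewrite mem_enum => /(subsetP sSD); apply: bnd.
apply: (@leq_trans #|W|); last first.
  by apply: leq_trans cW _; rewrite leq_pexp2l //= -cardE.
apply: subset_leq_card; rewrite /= gen_subG.
apply/subsetP=> _ /imset2P[d y dD yD ->].
have [s sS val_ds] : exists2 s, s \in S & val_T d = val_T s.
  by apply/imsetP; rewrite imS imset_f.
have sD := subsetP sSD s sS.
have dsD : (d - s)%R \in D by apply: (@groupM L) => //; apply: (@groupVr L).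
have -> : lie d y = (lie (d - s) y + lie s y)%R by rewrite -lieDl subrK.
apply: (@groupM L).
  apply: (subsetP (sW a (mem_head _ _))).
  apply: (subsetP (killT _ dsD _)); last exact: imset_f.
  move=> t tT; have := congr1 (fun g : {ffun L -> L} => g t) val_ds.
  by rewrite !ffunE tT lieDl lieNl => ->; rewrite subrr.
by apply: (subsetP (sW s _)); rewrite ?inE ?mem_enum ?sS ?orbT // imset_f.
Qed.

(** * Near-central elements *)

Local Open Scope nat_scope.

Definition near_central n : {set L} := [set x | #|lie x @: [set: L]| <= n].

Lemma near_centralD n p x y :
  x \in near_central n -> y \in near_central p ->
  (x + y)%R \in near_central (n * p).
Proof.
rewrite !inE => xn yp.
apply: leq_trans (leq_trans (card_mulg_leq _ _) (leq_mul xn yp)).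
apply/subset_leq_card/subsetP=> _ /imsetP[z _ ->]; rewrite lieDl.
by apply: (@mem_mulg L); apply: imset_f.
Qed.

Lemma near_centralN n x :
  x \in near_central n -> (- x)%R \in near_central n.
Proof.
rewrite !inE; apply: leq_trans.
apply/subset_leq_card/subsetP=> _ /imsetP[z _ ->].
by rewrite lieNl -lieNr imset_f ?inE.
Qed.

(** By the Jacobi identity, [[z, x], L] lies in [z, [x, L]] + [x, L]. *)
Lemma near_central_lie n x z :
  x \in near_central n -> lie z x \in near_central (n * n).
Proof.
rewrite !inE => xn.
apply: leq_trans (leq_mul (leq_trans (leq_imset_card (lie z) _) xn) xn).
apply: leq_trans (card_mulg_leq _ _).
apply/subset_leq_card/subsetP=> _ /imsetP[y _ ->].
rewrite lie_lie -lieNr; apply: (@mem_mulg L); last exact: imset_f.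
by do 2!apply: imset_f.
Qed.

Lemma near_central0 n : 0 < n -> 0%R \in near_central n.
Proof.
move=> n_gt0; rewrite inE; apply: leq_trans n_gt0.
rewrite -(cards1 (0%R : L)); apply/subset_leq_card/subsetP=> _ /imsetP[y _ ->].
by rewrite lie0l inE.
Qed.

Lemma card_commuting_pairs :
  #|[set p : L * L | lie p.1 p.2 == 0%R]|
    = \sum_(x : L) #|[set y | lie x y == 0%R]|.
Proof.
under [RHS]eq_bigr do rewrite -sum1dep_card.
by rewrite pair_big_dep sum1dep_card.
Qed.

(** The elements that are not 2k-central have centralisers of order less than
    |L|/(2k), so that they account for at most half of the commuting pairs. *)
Lemma card_near_central k :
    #|L| ^ 2 <= k * #|[set p : L * L | lie p.1 p.2 == 0%R]| ->
  #|L| <= 2 * k * #|near_central (2 * k)|.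
Proof.
set P := #|_| => hP.
have L0 : 0 < #|L| by apply/card_gt0P; exists 0%R.
have hsum : 2 * k * P <= 2 * k * #|near_central (2 * k)| * #|L| + #|L| * #|L|.
  rewrite /P card_commuting_pairs (bigID (mem (near_central (2 * k)))) /=.
  rewrite mulnDr leq_add //.
    rewrite -(mulnA (2 * k)) leq_mul //.
    apply: (@leq_trans (\sum_(x in near_central (2 * k)) #|L|)).
      by apply: leq_sum => x _; apply: max_card.
    by rewrite sum_nat_const.
  rewrite big_distrr /=; apply: (@leq_trans (\sum_(x : L) #|L|)); last first.
    by rewrite sum_nat_const.
  rewrite [leqRHS](bigID (mem (near_central (2 * k)))) /=.
  apply: leq_trans (leq_addl _ _); apply: leq_sum => x.
  rewrite inE -ltnNge => /ltnW x_big.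
  by rewrite -(card_lie_centraliser x) mulnC leq_mul2l x_big orbT.
rewrite -(leq_pmul2r L0) -(leq_add2r (#|L| * #|L|)).
apply: leq_trans hsum.
by rewrite mulnn addnn -mul2n -mulnA leq_mul2l.
Qed.

(** With bounds squared at each step, the chain of near-central sets starts with
    density at least 1/(2k) and would double every three steps, so it stalls
    before step 3 * 2k because 2k < 2 ^ (2k).  A set at which it stalls is closed under
    sums and under brackets with L. *)
Lemma near_central_ideal k :
    #|L| ^ 2 <= k * #|[set p : L * L | lie p.1 p.2 == 0%R]| ->
  exists D : {group L}, [/\ lie_ideal D, #|[set: L] : D| <= 2 * k &
    forall d, d \in D ->
      #|lie d @: [set: L]| <= (2 * k) ^ (2 ^ (3 * (2 * k)))].
Proof.
move=> cpk; have dense := card_near_central cpk.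
have L0 : 0 < #|L| by apply/card_gt0P; exists 0%R.
have k_gt0 : 0 < 2 * k.
  by move: (leq_trans L0 dense); rewrite muln_gt0 => /andP[].
pose bound i := (2 * k) ^ (2 ^ i).
have bound_gt0 i : 0 < bound i by rewrite expn_gt0 k_gt0.
have boundS i : bound i.+1 = bound i * bound i.
  by rewrite /bound -expnD addnn -mul2n -expnS.
pose E i := near_central (bound i).
have E0 i : 0%R \in E i by apply: near_central0.
have EN i x : x \in E i -> (- x)%R \in E i by apply: near_centralN.
have ED i x y : x \in E i -> y \in E i -> (x + y)%R \in E i.+1.
  by rewrite /E boundS; apply: near_centralD.
have [||j ltj stall] := @squaring_chain_stalls L E (2 * k) E0 EN.
- by move=> i; apply/subsetP=> _ /mulsgP[x y xE yE ->]; apply: ED.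
- apply: leq_ltn_trans dense _; rewrite /E /bound expn0 expn1 ltn_pmul2r.
    exact: ltn_expl.
  by apply/card_gt0P; exists 0%R; apply: near_central0.
have gE : group_set (E j).
  apply/group_setP; split=> [|x y xE yE]; first exact: E0.
  by rewrite stall; apply: ED.
exists (Group gE); split=> [x d /= dE|/=|d /= dE].
- by rewrite stall /E boundS; apply: near_central_lie.
- have sE0 : near_central (2 * k) \subset E j.
    apply/subsetP=> x; rewrite !inE => /leq_trans; apply.
    by rewrite -{1}(expn1 (2 * k)) leq_pexp2l // expn_gt0.
  rewrite -(leq_pmul2l (cardG_gt0 (Group gE))) Lagrange ?subsetT // cardsT.
  by rewrite mulnC (leq_trans dense) // leq_mul2l (subset_leq_card sE0) orbT.
- move: dE; rewrite inE => /leq_trans; apply.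
  by rewrite leq_pexp2l // leq_pexp2l // ltnW.
Qed.

End LieImages.

(** * Neumann's theorem for finite Lie rings *)

Theorem theorem1p1 (R : realType) :
  exists f : unit_oc R -> nat,
    forall L : finLieRingType,
      exists D : {group L},
        [/\ lie_ideal D,
            #|[set: L] : D|%g <= f (cp_oc R L) &
            #|lie_derived D| <= f (cp_oc R L)].
Proof.
pose inv_bound (e : unit_oc R) : nat := Num.bound (sval e)^-1%R.
pose central_bound k := ((2 * k) ^ (2 ^ (3 * (2 * k))))%N.
pose derived_bound k :=
  (central_bound k ^ (central_bound k ^ central_bound k).+1)%N.
exists (fun e => 2 * inv_bound e + derived_bound (inv_bound e))%N => L.
set k := inv_bound _.
have cpk : #|L| ^ 2 <= k * #|[set p : L * L | lie p.1 p.2 == 0%R]|.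
  have /andP[cp_gt0 _] := cp_itv R L.
  have L2 : (0 < #|L|%:R ^+ 2 :> R)%R.
    by rewrite exprn_gt0 // ltr0n; apply/card_gt0P; exists 0%R.
  have : ((cp R L)^-1 < k%:R)%R by apply: archi_boundP; rewrite invr_ge0 ltW.
  rewrite -[X in (X < _)%R]mul1r ltr_pdivrMr // /cp mulrA ltr_pdivlMr // mul1r.
  by rewrite -natrX -natrM ltr_nat => /ltnW.
have [D [idD indexD centralD]] := near_central_ideal cpk.
exists D; split=> //; first exact: leq_trans indexD (leq_addr _ _).
apply: leq_trans (leq_addl _ _).
apply: card_lie_derived => d dD.
by apply: leq_trans (centralD d dD); apply/subset_leq_card/imsetS/subsetT.
Qed.
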